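(* Let $k\ge 0$ and $0 \le \alpha \le 7$ be integers, and let $A = A_{8k+\alpha}$ be the real algebra $A_{8k} = M(2^{4k}, \mathbb{R})$, $A_{8k+1} = M(2^{4k}, \mathbb{C})$, $A_{8k+2} = M(2^{4k}, \mathbb{H})$, $A_{8k+3} = M(2^{4k}, \mathbb{H}) \oplus M(2^{4k}, \mathbb{H})$, $A_{8k+4} = M(2^{4k+1}, \mathbb{H})$, $A_{8k+5} = M(2^{4k+2}, \mathbb{C})$, $A_{8k+6} = M(2^{4k+3}, \mathbb{R})$, $A_{8k+7} = M(2^{4k+3}, \mathbb{R}) \oplus M(2^{4k+3}, \mathbb{R})$. Then there exists an isomorphism of real algebras $\rho : C\ell(8k+\alpha) \to A$ such that $\rho(c(x)) = \rho(x)^{*}$ for all $x \in C\ell(8k+\alpha)$.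
   Context: $C\ell(n)$ denotes the Clifford algebra of $\mathbb{R}^n$ with the standard positive definite form $Q(e_i,e_j)=\delta_{ij}$, with the sign convention $v^2 = -Q(v,v)1$; i.e. the universal associative unital real algebra containing $\mathbb{R}^n$ in which $v\cdot v = -Q(v,v)1$ for all $v\in\mathbb{R}^n$. The map $c : C\ell(n) \to C\ell(n)$ is the unique algebra anti-automorphism with $c(v)=-v$ for all $v\in\mathbb{R}^n$. $M(m,K)$ is the real algebra of $m\times m$ matrices over $K = \mathbb{R},\mathbb{C},\mathbb{H}$. For $K=\mathbb{R},\mathbb{C}$ the product is the usual one; for $K=\mathbb{H}$ the convention used is $(A\cdot B)_{ij} = \sum_{k} B_{kj} A_{ik}$ (the composition law for matrices acting on the left $\mathbb{H}$-module $\mathbb{H}^m$ by $(Ax)_i = \sum_k x_k A_{ik}$). The operation $^*$ is the conjugate transpose, $(A^* )_{ij} = \overline{A_{ji}}$; on a direct sum, $(X,Y)^* = (X^*,Y^* )$. *)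

(* Defs.v *)
From HB Require Import structures.
From mathcomp Require Import all_boot all_order all_algebra.
From mathcomp Require Import boolp reals ring complex.

Set Implicit Arguments.
Unset Strict Implicit.
Unset Printing Implicit Defensive.

Import Order.TTheory GRing.Theory Num.Theory.
Local Open Scope ring_scope.
Local Open Scope quotient_scope.

HB.mixin Record Algebra_isStar (R : pzRingType) A of GRing.Algebra R A := {
  star : A -> A;
  starK : involutive star;
  starP : forall (a : R) x y, star (a *: x + y) = a *: star x + star y;
  starM : forall x y, star (x * y) = star y * star x
}.

#[short(type="starAlgType")]
HB.structure Definition StarAlgebra (R : pzRingType) :=
  {A of GRing.Algebra R A & Algebra_isStar R A}.

Section ConverseAlgebra.
Variables (R : comNzRingType) (A : algType R).

HB.instance Definition _ := GRing.Lmodule.copy A^c A.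

Fact converse_scalerAl (a : R) (x y : A^c) : a *: (x * y) = (a *: x : A^c) * y.
Proof. exact: (@scalerAr R A a y x). Qed.

HB.instance Definition _ := GRing.Lmodule_isLalgebra.Build R A^c converse_scalerAl.

Fact converse_scalerAr (a : R) (x y : A^c) : a *: (x * y) = x * (a *: y : A^c).
Proof. exact: (@scalerAl R A a y x). Qed.

HB.instance Definition _ := GRing.Lalgebra_isAlgebra.Build R A^c converse_scalerAr.

End ConverseAlgebra.

Section ConverseStar.
Variables (R : comNzRingType) (A : starAlgType R).

Fact converse_starM (x y : A^c) : star (x * y : A^c) = (star y : A^c) * (star x : A^c).
Proof. exact: (@starM R A y x). Qed.

HB.instance Definition _ := Algebra_isStar.Build R A^c
  (@starK R A) (@starP R A) converse_starM.

End ConverseStar.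

Section PairStar.
Variables (R : comNzRingType) (A B : starAlgType R).

Definition pair_star (x : A * B) : A * B := (star x.1, star x.2).

Fact pair_starK : involutive pair_star.
Proof. by case=> x y; rewrite /pair_star /= !starK. Qed.

Fact pair_starP (a : R) x y :
  pair_star (a *: x + y) = a *: pair_star x + pair_star y.
Proof. by rewrite /pair_star /= !starP. Qed.

Fact pair_starM x y : pair_star (x * y) = pair_star y * pair_star x.
Proof. by rewrite /pair_star /= !starM. Qed.

HB.instance Definition _ := Algebra_isStar.Build R (A * B)%type
  pair_starK pair_starP pair_starM.

End PairStar.

Section RealStar.
Variable R : comNzRingType.

Fact real_starM (x y : R^o) : (x * y : R^o) = y * x.
Proof. exact: mulrC. Qed.

HB.instance Definition _ := Algebra_isStar.Build R R^o
  (star := id) (fun _ => erefl) (fun _ _ _ => erefl) real_starM.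

End RealStar.

(* [Rcomplex R] is the library's alias of [R[i]] that carries the structure of
   an algebra over [R] (whereas [R[i]] is an algebra over itself). *)
Section ComplexStar.
Variable R : realType.

Fact Rcomplex_scalerAr (a : R) (x y : Rcomplex R) : a *: (x * y) = x * (a *: y).
Proof. by rewrite mulrC scalerAl mulrC. Qed.

HB.instance Definition _ :=
  GRing.Lalgebra_isAlgebra.Build R (Rcomplex R) Rcomplex_scalerAr.

Definition Rconjc (x : Rcomplex R) : Rcomplex R := conjc x.

Fact RconjcK : involutive Rconjc.
Proof. exact: conjcK. Qed.

Fact RconjcP (a : R) x y : Rconjc (a *: x + y) = a *: Rconjc x + Rconjc y.
Proof. by case: x y => [x1 x2] [y1 y2]; congr Complex; rewrite /=; ring. Qed.

Fact RconjcM x y : Rconjc (x * y) = Rconjc y * Rconjc x.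
Proof. by case: x y => [x1 x2] [y1 y2]; congr Complex; rewrite /=; ring. Qed.

HB.instance Definition _ := Algebra_isStar.Build R (Rcomplex R)
  RconjcK RconjcP RconjcM.

End ComplexStar.

(* [Quat a b c d] is a + b i + c j + d k. *)
Record quat (R : Type) : Type := Quat { q0 : R; q1 : R; q2 : R; q3 : R }.

Section Quaternions.
Variable R : comNzRingType.
Implicit Types (x y z : quat R) (a : R).

Definition quat_tuple x := (q0 x, q1 x, q2 x, q3 x).
Definition tuple_quat (t : R * R * R * R) :=
  let: (a, b, c, d) := t in Quat a b c d.

Fact quat_tupleK : cancel quat_tuple tuple_quat.
Proof. by case. Qed.

HB.instance Definition _ := Choice.copy (quat R) (can_type quat_tupleK).

Definition addq x y :=
  Quat (q0 x + q0 y) (q1 x + q1 y) (q2 x + q2 y) (q3 x + q3 y).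
Definition oppq x := Quat (- q0 x) (- q1 x) (- q2 x) (- q3 x).
Definition scaleq a x := Quat (a * q0 x) (a * q1 x) (a * q2 x) (a * q3 x).
Definition mulq x y := Quat
  (q0 x * q0 y - q1 x * q1 y - q2 x * q2 y - q3 x * q3 y)
  (q0 x * q1 y + q1 x * q0 y + q2 x * q3 y - q3 x * q2 y)
  (q0 x * q2 y - q1 x * q3 y + q2 x * q0 y + q3 x * q1 y)
  (q0 x * q3 y + q1 x * q2 y - q2 x * q1 y + q3 x * q0 y).
Definition conjq x := Quat (q0 x) (- q1 x) (- q2 x) (- q3 x).

Local Ltac quat_ring :=
  repeat (let x := fresh in intros x; try destruct x);
  rewrite /addq /oppq /scaleq /mulq /conjq; congr Quat; rewrite /=; ring.

Fact addqA : associative addq. Proof. quat_ring. Qed.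
Fact addqC : commutative addq. Proof. quat_ring. Qed.
Fact add0q : left_id (Quat 0 0 0 0) addq. Proof. quat_ring. Qed.
Fact addNq : left_inverse (Quat 0 0 0 0) oppq addq. Proof. quat_ring. Qed.

HB.instance Definition _ :=
  GRing.isZmodule.Build (quat R) addqA addqC add0q addNq.

Fact mulqA : associative mulq. Proof. quat_ring. Qed.
Fact mul1q : left_id (Quat 1 0 0 0) mulq. Proof. quat_ring. Qed.
Fact mulq1 : right_id (Quat 1 0 0 0) mulq. Proof. quat_ring. Qed.
Fact mulqDl : left_distributive mulq addq. Proof. quat_ring. Qed.
Fact mulqDr : right_distributive mulq addq. Proof. quat_ring. Qed.
Fact oneq_neq0 : Quat 1 0 0 0 != 0 :> quat R.
Proof. by apply/eqP => -[] /eqP; rewrite oner_eq0. Qed.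

HB.instance Definition _ := GRing.Zmodule_isNzRing.Build (quat R)
  mulqA mul1q mulq1 mulqDl mulqDr oneq_neq0.

Fact scaleqA a b x : scaleq a (scaleq b x) = scaleq (a * b) x.
Proof. move: a b x; quat_ring. Qed.
Fact scale1q : left_id 1 scaleq. Proof. quat_ring. Qed.
Fact scaleqDr : right_distributive scaleq +%R. Proof. quat_ring. Qed.
Fact scaleqDl x : {morph scaleq^~ x : a b / a + b}.
Proof. move: x; quat_ring. Qed.

HB.instance Definition _ := GRing.Zmodule_isLmodule.Build R (quat R)
  scaleqA scale1q scaleqDr scaleqDl.

Fact scaleqAl a x y : a *: (x * y) = a *: x * y.
Proof. move: a x y; quat_ring. Qed.

HB.instance Definition _ := GRing.Lmodule_isLalgebra.Build R (quat R) scaleqAl.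

Fact scaleqAr a x y : a *: (x * y) = x * (a *: y).
Proof. move: a x y; quat_ring. Qed.

HB.instance Definition _ := GRing.Lalgebra_isAlgebra.Build R (quat R) scaleqAr.

Fact conjqK : involutive conjq. Proof. quat_ring. Qed.
Fact conjqP a x y : conjq (a *: x + y) = a *: conjq x + conjq y.
Proof. move: a x y; quat_ring. Qed.
Fact conjqM x y : conjq (x * y) = conjq y * conjq x.
Proof. move: x y; quat_ring. Qed.

HB.instance Definition _ := Algebra_isStar.Build R (quat R)
  conjqK conjqP conjqM.

End Quaternions.

(* [mxalg K e] is M(2^e, K), as an algebra over the base ring [R] of [K]
   ([matrix] by itself is only an algebra over its ring of entries); the sizes
   are restricted to powers of 2 because [algType] requires 1 <> 0. *)
Definition mxalg (R : comNzRingType) (K : starAlgType R) (e : nat) :=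
  'M[K]_(2 ^ e).

Section MatrixAlgebra.
Variables (R : comNzRingType) (K : starAlgType R) (e : nat).
Local Notation M := (mxalg K e).

HB.instance Definition _ := GRing.PzRing.copy M 'M[K]_(2 ^ e).

Fact mxalg_oner_neq0 : 1 != 0 :> M.
Proof.
have e_gt0 : (0 < 2 ^ e)%N by rewrite expn_gt0.
apply/eqP => /matrixP/(_ (Ordinal e_gt0) (Ordinal e_gt0)).
by rewrite !mxE eqxx => /eqP; rewrite oner_eq0.
Qed.

HB.instance Definition _ := GRing.PzSemiRing_isNonZero.Build M mxalg_oner_neq0.

Definition mxalg_scale (a : R) (A : M) : M := map_mx ( *:%R a) A.

Fact mxalg_scaleA a b A : mxalg_scale a (mxalg_scale b A) = mxalg_scale (a * b) A.
Proof. by apply/matrixP => i j; rewrite !mxE scalerA. Qed.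
Fact mxalg_scale1 : left_id 1 mxalg_scale.
Proof. by move=> A; apply/matrixP => i j; rewrite !mxE scale1r. Qed.
Fact mxalg_scaleDr : right_distributive mxalg_scale +%R.
Proof. by move=> a A B; apply/matrixP => i j; rewrite !mxE scalerDr. Qed.
Fact mxalg_scaleDl A : {morph mxalg_scale^~ A : a b / a + b}.
Proof. by move=> a b; apply/matrixP => i j; rewrite !mxE scalerDl. Qed.

HB.instance Definition _ := GRing.Zmodule_isLmodule.Build R M
  mxalg_scaleA mxalg_scale1 mxalg_scaleDr mxalg_scaleDl.

Fact mxalg_scaleAl (a : R) (A B : M) : a *: (A * B) = a *: A * B.
Proof.
apply/matrixP => i j; rewrite !mxE scaler_sumr.
by apply: eq_bigr => l _; rewrite !mxE scalerAl.
Qed.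

HB.instance Definition _ := GRing.Lmodule_isLalgebra.Build R M mxalg_scaleAl.

Fact mxalg_scaleAr (a : R) (A B : M) : a *: (A * B) = A * (a *: B).
Proof.
apply/matrixP => i j; rewrite !mxE scaler_sumr.
by apply: eq_bigr => l _; rewrite !mxE scalerAr.
Qed.

HB.instance Definition _ := GRing.Lalgebra_isAlgebra.Build R M mxalg_scaleAr.

Definition mxalg_star (A : M) : M := \matrix_(i, j) star (A j i).

Fact mxalg_starK : involutive mxalg_star.
Proof. by move=> A; apply/matrixP => i j; rewrite !mxE starK. Qed.

Fact mxalg_starP (a : R) (A B : M) :
  mxalg_star (a *: A + B) = a *: mxalg_star A + mxalg_star B.
Proof. by apply/matrixP => i j; rewrite !mxE starP. Qed.

Fact mxalg_starM (A B : M) : mxalg_star (A * B) = mxalg_star B * mxalg_star A.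
Proof.
apply/matrixP => i j; rewrite !mxE.
have starD (x y : K) : star (x + y) = star x + star y.
  by have := starP 1 x y; rewrite !scale1r.
have star0 : star (0 : K) = 0.
  by apply: (addrI (star 0)); rewrite -starD !addr0.
rewrite (big_morph _ starD star0).
by apply: eq_bigr => l _; rewrite !mxE starM.
Qed.

HB.instance Definition _ := Algebra_isStar.Build R M
  mxalg_starK mxalg_starP mxalg_starM.

End MatrixAlgebra.

Section MatrixOverRCH.
Variable R : realType.

Definition mxR (e : nat) : starAlgType R := mxalg R^o e.
Definition mxC (e : nat) : starAlgType R := mxalg (Rcomplex R) e.
(* The entries are multiplied in the converse ring, which amounts to the
   product (A . B)_ij = \sum_l B_lj A_il; see [mxH_mulE]. *)
Definition mxH (e : nat) : starAlgType R := mxalg (quat R)^c e.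

Lemma mxH_mulE e (A B : 'M[quat R]_(2 ^ e)) i j :
  ((A : mxH e) * (B : mxH e) : 'M[quat R]_(2 ^ e)) i j =
  \sum_l B l j * A i l :> quat R.
Proof. by rewrite mxE. Qed.

Lemma mxH_starE e (A : 'M[quat R]_(2 ^ e)) i j :
  (star (A : mxH e) : 'M[quat R]_(2 ^ e)) i j = conjq (A j i).
Proof. by rewrite mxE. Qed.

(* Only meaningful for alpha <= 7. *)
Definition clifford_mxalg (k alpha : nat) : starAlgType R :=
  match alpha with
  | 0 => mxR (4 * k)
  | 1 => mxC (4 * k)
  | 2 => mxH (4 * k)
  | 3 => (mxH (4 * k) * mxH (4 * k))%type
  | 4 => mxH (4 * k + 1)
  | 5 => mxC (4 * k + 2)
  | 6 => mxR (4 * k + 3)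
  | _ => (mxR (4 * k + 3) * mxR (4 * k + 3))%type
  end.

End MatrixOverRCH.

Definition stdform (R : realType) (n : nat) (v w : 'rV[R]_n) : R :=
  \sum_i v 0 i * w 0 i.

Definition is_clifford_map (R : realType) (n : nat) (A : algType R)
    (f : 'rV[R]_n -> A) : Prop :=
  forall v, f v * f v = - (stdform v v)%:A.

Definition is_clifford_algebra (R : realType) (n : nat) (Cl : algType R)
    (iota : {linear 'rV[R]_n -> Cl}) : Prop :=
  is_clifford_map iota /\
  forall (A : algType R) (f : {linear 'rV[R]_n -> A}), is_clifford_map f ->
    (exists g : {lrmorphism Cl -> A}, forall v, g (iota v) = f v) /\
    (forall g h : {lrmorphism Cl -> A},
       (forall v, g (iota v) = f v) -> (forall v, h (iota v) = f v) -> g =1 h).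

Definition is_clifford_conj (R : realType) (n : nat) (Cl : algType R)
    (iota : {linear 'rV[R]_n -> Cl}) (c : {linear Cl -> Cl}) : Prop :=
  [/\ bijective c,
      forall x y, c (x * y) = c y * c x
    & forall v, c (iota v) = - iota v].

Section CliffordModel.
Variable R : realType.

Fact stdformS n (v : 'rV[R]_(1 + n)) :
  stdform v v = v 0 0 * v 0 0 + stdform (rsubmx v) (rsubmx v).
Proof.
rewrite /stdform big_ord_recl; congr (_ + _).
by apply: eq_bigr => i _; rewrite !mxE; congr (v _ _ * v _ _); apply: val_inj.
Qed.

Fact lrmorph_alg (A B : algType R) (g : {lrmorphism A -> B}) (a : R) :
  g a%:A = a%:A.
Proof. by rewrite linearZ /= rmorph1. Qed.

Fact lrmorph_oppalg (A B : algType R) (g : {lrmorphism A -> B}) (a : R) :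
  g (- a%:A) = - a%:A.
Proof. by rewrite rmorphN; congr (- _); exact: lrmorph_alg. Qed.

Fact clifford_model n :
  exists (m : nat) (f : {linear 'rV[R]_n -> 'M[R]_m.+1}), is_clifford_map f.
Proof.
elim: n => [|n [m [f fP]]].
  exists 0, \0%R => v.
  by rewrite /stdform big_ord0 scale0r oppr0 mulr0.
pose g (v : 'rV[R]_(1 + n)) : 'M[R]_(m.+1 + m.+1) :=
  block_mx (f (rsubmx v)) (v 0 0)%:M (- (v 0 0)%:M) (- f (rsubmx v)).
have g_lin : linear g.
  move=> a v w; rewrite /g scale_block_mx add_block_mx; congr block_mx.
  - by rewrite !linearP.
  - by apply/matrixP => i j; rewrite !mxE; case: (i == j);
      rewrite ?mulr1n ?mulr0n; ring.
  - by apply/matrixP => i j; rewrite !mxE; case: (i == j);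
      rewrite ?mulr1n ?mulr0n; ring.
  - by rewrite !linearP.
pose gL := GRing.isLinear.Build R _ _ _ g g_lin.
pose g' : {linear 'rV[R]_n.+1 -> 'M[R]_((m + m.+1).+1)} := HB.pack g gL.
exists (m + m.+1)%N, g' => v.
have fv : f (rsubmx (v : 'rV_(1 + n))) *m f (rsubmx (v : 'rV_(1 + n))) = _ :=
  fP (rsubmx (v : 'rV_(1 + n))).
rewrite (stdformS v).
set q := stdform (rsubmx _) (rsubmx _) in fv *; set t := v 0 0.
change (g v *m g v = - ((t * t + q) *: (1%:M : 'M[R]_(m.+1 + m.+1)))).
rewrite /g mulmx_block !mulmxN !mulNmx !opprK fv -/t.
change (- q%:A) with (- (q *: (1%:M : 'M[R]_m.+1))).
rewrite -!scalar_mxM scalar_mxC addrN addNr !scalemx1.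
rewrite scalar_mx_block opp_block_mx oppr0 raddfD opprD /=.
by rewrite [- q%:M - _]addrC.
Qed.
End CliffordModel.

(* The algebra of formal expressions in the vectors of R^n and in real
   constants, modulo the equalities valid in every algebra with a map
   satisfying [is_clifford_map]. *)
Section CliffordExistence.
Variables (R : realType) (n : nat).

Inductive clterm : Type :=
  | CVar of 'rV[R]_n | CCst of R | CAdd of clterm & clterm
  | CMul of clterm & clterm.

HB.instance Definition _ := gen_eqMixin clterm.
HB.instance Definition _ := gen_choiceMixin clterm.

Fixpoint cleval (A : algType R) (f : 'rV[R]_n -> A) (t : clterm) : A :=
  match t with
  | CVar v => f v
  | CCst a => a%:A
  | CAdd s t => cleval f s + cleval f t
  | CMul s t => cleval f s * cleval f t
  end.

Definition cleq (s t : clterm) : bool := `[< forall (A : algType R)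
  (f : {linear 'rV[R]_n -> A}), is_clifford_map f -> cleval f s = cleval f t >].

Fact cleq_refl : reflexive cleq.
Proof. by move=> s; apply/asboolP. Qed.
Fact cleq_sym : symmetric cleq.
Proof. by move=> s t; apply/asboolP/asboolP => h A f fP; rewrite h. Qed.
Fact cleq_trans : transitive cleq.
Proof.
move=> t s u /asboolP st /asboolP tu; apply/asboolP => A f fP.
by rewrite st ?tu.
Qed.

Canonical cleq_equiv := EquivRel cleq cleq_refl cleq_sym cleq_trans.

Definition clquot := {eq_quot cleq}.
HB.instance Definition _ := Choice.on clquot.

Definition clpi (t : clterm) : clquot := \pi_{eq_quot cleq} t.
Definition clev (A : algType R) (f : 'rV[R]_n -> A) (x : clquot) : A :=
  cleval f (repr x).

Lemma clev_pi (A : algType R) (f : {linear 'rV[R]_n -> A}) t :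
  is_clifford_map f -> clev f (clpi t) = cleval f t.
Proof.
move=> fP; rewrite /clev.
have : repr (clpi t) = t %[mod {eq_quot cleq}] by rewrite reprK.
by move/eqmodP/asboolP; apply.
Qed.

Lemma clquotP (x y : clquot) : (forall (A : algType R)
  (f : {linear 'rV[R]_n -> A}), is_clifford_map f -> clev f x = clev f y) ->
  x = y.
Proof.
move=> xy; rewrite -[x]reprK -[y]reprK.
by apply/eqmodP/asboolP => A f fP; apply: xy.
Qed.

Definition cladd (x y : clquot) := clpi (CAdd (repr x) (repr y)).
Definition clmul (x y : clquot) := clpi (CMul (repr x) (repr y)).
Definition clscale (a : R) (x : clquot) := clpi (CMul (CCst a) (repr x)).
Definition clopp (x : clquot) := clscale (-1) x.
Definition clvec (v : 'rV[R]_n) := clpi (CVar v).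

Lemma clevD (A : algType R) (f : {linear 'rV[R]_n -> A}) x y :
  is_clifford_map f -> clev f (cladd x y) = clev f x + clev f y.
Proof. exact: clev_pi. Qed.
Lemma clevM (A : algType R) (f : {linear 'rV[R]_n -> A}) x y :
  is_clifford_map f -> clev f (clmul x y) = clev f x * clev f y.
Proof. exact: clev_pi. Qed.
Lemma clevZ (A : algType R) (f : {linear 'rV[R]_n -> A}) a x :
  is_clifford_map f -> clev f (clscale a x) = a *: clev f x.
Proof. by move=> fP; rewrite clev_pi //= mulr_algl. Qed.
Lemma clevN (A : algType R) (f : {linear 'rV[R]_n -> A}) x :
  is_clifford_map f -> clev f (clopp x) = - clev f x.
Proof. by move=> fP; rewrite clevZ // scaleN1r. Qed.
Lemma clevC (A : algType R) (f : {linear 'rV[R]_n -> A}) a :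
  is_clifford_map f -> clev f (clpi (CCst a)) = a%:A.
Proof. exact: clev_pi. Qed.

Local Ltac cl_law := repeat intro; apply: clquotP => A f fP;
  rewrite ?(clevD, clevM, clevZ, clevN, clevC) // ?(scale0r, scale1r).

Fact claddA : associative cladd.
Proof. by cl_law; rewrite addrA. Qed.
Fact claddC : commutative cladd.
Proof. by cl_law; rewrite addrC. Qed.
Fact cladd0 : left_id (clpi (CCst 0)) cladd.
Proof. by move=> x; cl_law; rewrite add0r. Qed.
Fact claddN : left_inverse (clpi (CCst 0)) clopp cladd.
Proof. by move=> x; cl_law; rewrite addNr. Qed.

HB.instance Definition _ := GRing.isZmodule.Build clquot
  claddA claddC cladd0 claddN.

Fact clmulA : associative clmul.
Proof. by cl_law; rewrite mulrA. Qed.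
Fact clmul1 : left_id (clpi (CCst 1)) clmul.
Proof. by move=> x; cl_law; rewrite mul1r. Qed.
Fact clmulr1 : right_id (clpi (CCst 1)) clmul.
Proof. by move=> x; cl_law; rewrite mulr1. Qed.
Fact clmulDl : left_distributive clmul cladd.
Proof. by move=> x y z; cl_law; rewrite mulrDl. Qed.
Fact clmulDr : right_distributive clmul cladd.
Proof. by move=> x y z; cl_law; rewrite mulrDr. Qed.
Fact cl1_neq0 : clpi (CCst 1) != 0 :> clquot.
Proof.
have [m [f fP]] := clifford_model R n.
apply/eqP => /(congr1 (clev f)); rewrite !clevC // scale1r scale0r.
by apply/eqP; exact: oner_neq0.
Qed.

HB.instance Definition _ := GRing.Zmodule_isNzRing.Build clquot
  clmulA clmul1 clmulr1 clmulDl clmulDr cl1_neq0.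

Fact clscaleA a b x : clscale a (clscale b x) = clscale (a * b) x.
Proof. by cl_law; rewrite scalerA. Qed.
Fact clscale1 : left_id 1 clscale.
Proof. by move=> x; cl_law. Qed.
Fact clscaleDr : right_distributive clscale +%R.
Proof. by move=> a x y; cl_law; rewrite scalerDr. Qed.
Fact clscaleDl x : {morph clscale^~ x : a b / a + b}.
Proof. by move=> a b; cl_law; rewrite scalerDl. Qed.

HB.instance Definition _ := GRing.Zmodule_isLmodule.Build R clquot
  clscaleA clscale1 clscaleDr clscaleDl.

Fact clscaleAl (a : R) (x y : clquot) : a *: (x * y) = a *: x * y.
Proof. by cl_law; rewrite scalerAl. Qed.

HB.instance Definition _ := GRing.Lmodule_isLalgebra.Build R clquot clscaleAl.

Fact clscaleAr (a : R) (x y : clquot) : a *: (x * y) = x * (a *: y).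
Proof. by cl_law; rewrite scalerAr. Qed.

HB.instance Definition _ := GRing.Lalgebra_isAlgebra.Build R clquot clscaleAr.

Fact clvec_linear : linear (clvec : 'rV[R]_n -> clquot).
Proof.
by move=> a v w; cl_law; rewrite !clev_pi //= linearP.
Qed.

HB.instance Definition _ :=
  GRing.isLinear.Build R 'rV[R]_n clquot _ clvec clvec_linear.

Section ClevMorphism.
Variables (A : algType R) (f : {linear 'rV[R]_n -> A}).
Hypothesis fP : is_clifford_map f.

Let ev : clquot -> A := clev f.

Fact ev_linear : linear ev.
Proof. by move=> a x y; rewrite /ev clevD // clevZ. Qed.
Fact ev_monoid : monoid_morphism ev.
Proof. by split=> [|x y]; rewrite /ev ?clevM // clevC // scale1r. Qed.

Lemma clev_lrmorphism : exists g : {lrmorphism clquot -> A}, g =1 clev f.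
Proof.
pose m1 := GRing.isLinear.Build R clquot A _ ev ev_linear.
pose m2 := GRing.isMonoidMorphism.Build clquot A ev ev_monoid.
pose g : {lrmorphism clquot -> A} := HB.pack ev m1 m2.
by exists g.
Qed.

End ClevMorphism.

Theorem clifford_algebra_exists :
  exists (Cl : algType R) (iota : {linear 'rV[R]_n -> Cl}),
    is_clifford_algebra iota.
Proof.
exists clquot, clvec; split=> [v|A f fP].
  apply: clquotP => A f fP; have [ev evE] := clev_lrmorphism fP.
  rewrite -!evE [LHS](rmorphM ev) [RHS](lrmorph_oppalg ev).
  have evv : ev (clvec v) = f v by rewrite evE clev_pi.
  exact: etrans (congr2 *%R evv evv) (fP v).
split=> [|g h gf hf x].
  have [ev evE] := clev_lrmorphism fP.
  by exists ev => v; rewrite evE clev_pi.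
have piE t : clpi t = cleval clvec t.
  apply: clquotP => B k kP; have [ev evE] := clev_lrmorphism kP.
  rewrite clev_pi // -evE.
  elim: t => /= [v|a|s IHs t IHt|s IHs t IHt].
  - by rewrite evE clev_pi.
  - exact/esym/lrmorph_alg.
  - exact: etrans (congr2 +%R IHs IHt) (esym (rmorphD ev _ _)).
  - exact: etrans (congr2 *%R IHs IHt) (esym (rmorphM ev _ _)).
rewrite -[x]reprK -/(clpi _) piE; elim: (repr x) => /= [v|a|s IHs t IHt|s IHs t IHt].
- by rewrite gf hf.
- exact: etrans (lrmorph_alg g _) (esym (lrmorph_alg h _)).
- exact: etrans (rmorphD g _ _)
    (etrans (congr2 +%R IHs IHt) (esym (rmorphD h _ _))).
- exact: etrans (rmorphM g _ _)
    (etrans (congr2 *%R IHs IHt) (esym (rmorphM h _ _))).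
Qed.

End CliffordExistence.

Section CliffordTheory.
Variables (R : realType) (n : nat) (Cl : algType R).
Variables (iota : {linear 'rV[R]_n -> Cl}) (iotaP : is_clifford_algebra iota).

Lemma clifford_iota_inj : injective iota.
Proof.
move=> v w vw; apply/eqP; rewrite -subr_eq0; set u := v - w.
have : iota u * iota u = 0 by rewrite /u raddfB /= vw subrr mulr0.
have [-> _] := iotaP => /eqP; rewrite oppr_eq0 scaler_eq0 oner_eq0 orbF.
rewrite psumr_eq0 => [/allP u0|i _]; last by rewrite -expr2 sqr_ge0.
apply/eqP/rowP => i; have /implyP/(_ isT) := u0 i (mem_index_enum i).
by rewrite -expr2 sqrf_eq0 [RHS]mxE => /eqP.
Qed.

Theorem clifford_conj_exists :
  exists c : {linear Cl -> Cl}, is_clifford_conj iota c.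
Proof.
pose f (v : 'rV[R]_n) : Cl^c := - iota v.
have f_lin : linear f by move=> a v w; rewrite /f linearP opprD scalerN.
pose fL := GRing.isLinear.Build R 'rV[R]_n Cl^c _ f f_lin.
pose f' : {linear 'rV[R]_n -> Cl^c} := HB.pack f fL.
have [iotaQ univ] := iotaP.
have fP : is_clifford_map f'.
  by move=> v; rewrite -iotaQ -[LHS]/((- iota v) * (- iota v) : Cl) mulrNN.
have [[g gf] _] := univ _ _ fP.
pose c : Cl -> Cl := g.
have c_lin : linear c by move=> a x y; apply: (linearP g).
have cM x y : c (x * y) = c y * c x by apply: (rmorphM g).
have c1 : c 1 = 1 by apply: (rmorph1 g).
have c_iota v : c (iota v) = - iota v by apply: gf.
pose cL := GRing.isLinear.Build R Cl Cl _ c c_lin.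
pose c' : {linear Cl -> Cl} := HB.pack c cL.
have cN x : c (- x) = - c x by apply: (raddfN c').
pose d := c \o c.
have d_lin : linear d by move=> a x y; rewrite /d /= !c_lin.
have d_mon : monoid_morphism d by split=> [|x y]; rewrite /d /= ?c1 // !cM.
pose d1 := GRing.isLinear.Build R Cl Cl _ d d_lin.
pose d2 := GRing.isMonoidMorphism.Build Cl Cl d d_mon.
pose d' : {lrmorphism Cl -> Cl} := HB.pack d d1 d2.
have [_ uniq] := univ _ _ iotaQ.
have dK : d' =1 idfun.
  by apply: uniq => // v; rewrite -[LHS]/(c (c (iota v))) c_iota cN c_iota opprK.
by exists c'; split=> //; exists c' => x; apply: dK.
Qed.

End CliffordTheory.

(* Main.v *)
Require Import Defs.
From HB Require Import structures.
From mathcomp Require Import all_boot all_order all_algebra.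
From mathcomp Require Import boolp reals complex ring zify.
Import GRing.Theory Num.Theory.
Local Open Scope ring_scope.

Set Implicit Arguments.
Unset Strict Implicit.
Unset Printing Implicit Defensive.

(* Call a system of signature (p, q) in a star algebra A a generating family of
   p self-adjoint elements of square 1 and q skew-adjoint elements of square -1
   that anticommute pairwise. A system of signature (0, n) yields a surjection
   of Cl(n) onto A that turns c into star; as Cl(n) is spanned by 2^n elements,
   it is an isomorphism as soon as dim A >= 2^n. Systems of signatures (0, 0),
   (0, 1), (0, 2) in R, C, H are propagated by
     (p, q) in M(m, K) => (p + 1, q + 1) in M(2m, K),
     (p + 1, q) => (q + 1, p), multiplying the others by a vector e of square 1,
     (p + 4, q) => (p, q + 4), multiplying e1, ..., e4 by e1 e2 e3 e4,
     (0, n) in A => (0, n + 1) in A x A if n = 2 mod 4, adding (w, -w) where w is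
       the product of all the vectors. *)

(** * Systems of anticommuting unitary generators in a star algebra *)

Definition anticomm {A : pzRingType} (x y : A) := x * y == - (y * x).

Lemma anticomm_sym (A : pzRingType) : symmetric (@anticomm A).
Proof. by move=> x y; rewrite /anticomm -eqr_oppLR eq_sym. Qed.

Section CliffordSystems.
Variables (R : comNzRingType) (A : starAlgType R).
Implicit Types (x y u w : A) (s t ps ns : seq A) (S : A -> Prop) (b : bool).

Lemma starD x y : star (x + y) = star x + star y.
Proof. by have := starP 1 x y; rewrite !scale1r. Qed.

Lemma star0 : star (0 : A) = 0.
Proof. by apply: (addrI (star 0)); rewrite -starD !addr0. Qed.

Lemma starZ a x : star (a *: x) = a *: star x.
Proof. by have := starP a x 0; rewrite star0 !addr0. Qed.

Lemma starN x : star (- x) = - star x.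
Proof. by rewrite -!scaleN1r starZ. Qed.

Lemma star1 : star (1 : A) = 1.
Proof. by rewrite -[LHS]mul1r -{1}(starK 1) -starM mul1r starK. Qed.

(** [b] is the sign of the square: self-adjoint for [false], skew-adjoint for [true]. Unitarity is
    recorded instead of [x * x] because it passes to products. *)
Definition star_unit b x := x * star x = 1 /\ star x = (-1) ^+ b * x.

Definition subalg S :=
  [/\ S 1, forall a x y, S x -> S y -> S (a *: x + y)
    & forall x y, S x -> S y -> S (x * y)].

(** An induction principle over all subalgebras, so that no generated subalgebra has to be
    constructed. *)
Definition generates s := forall S, subalg S -> (forall x, x \in s -> S x) ->
  forall x, S x.

(* Since [x * star x = 1], the elements of [ps] square to 1 and those of [ns]
   to -1: they generate A as a quotient of the Clifford algebra of signature
   (size ps, size ns). *)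
Definition clifford_gens ps ns :=
  [/\ {in ps, forall x, star_unit false x}, {in ns, forall x, star_unit true x},
      pairwise anticomm (ps ++ ns) & generates (ps ++ ns)].

Definition clifford_system p q := exists ps ns,
  [/\ size ps = p, size ns = q & clifford_gens ps ns].

Section Subalgebra.
Variables (S : A -> Prop) (algS : subalg S).

Lemma subalg0 : S 0.
Proof. by case: algS => S1 SL _; have := SL (-1) _ _ S1 S1; rewrite scaleN1r addNr. Qed.

Lemma subalgZ a x : S x -> S (a *: x).
Proof. by case: algS => _ SL _ Sx; have := SL a _ _ Sx subalg0; rewrite addr0. Qed.

Lemma subalgN x : S x -> S (- x).
Proof. by rewrite -scaleN1r; apply: subalgZ. Qed.

Lemma subalgD x y : S x -> S y -> S (x + y).
Proof. by case: algS => _ SL _ Sx Sy; have := SL 1 _ _ Sx Sy; rewrite scale1r. Qed.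

End Subalgebra.

Lemma star_unit_sq b x : star_unit b x -> x * x = (-1) ^+ b.
Proof.
case=> x1 xs; rewrite xs mulrA commr_sign -mulrA in x1.
by rewrite -[LHS](signrMK b) x1 mulr1.
Qed.

(** Each factor that [x] crosses costs one sign. *)
Lemma prod_anticomm x s : (forall y, y \in s -> anticomm x y) ->
  x * \prod_(y <- s) y = (-1) ^+ size s * (\prod_(y <- s) y * x).
Proof.
elim: s => [|y s IHs] xs; first by rewrite big_nil mulr1 !mul1r.
rewrite big_cons mulrA (eqP (xs y (mem_head _ _))) mulNr -(mulrA y x) IHs; last first.
  by move=> z zs; apply: xs; rewrite inE zs orbT.
by rewrite exprS mulN1r mulNr (mulrA y) commr_sign !mulrA.
Qed.

(** One sign fewer than in [prod_anticomm], since [x] commutes with its own occurrence. *)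
Lemma mem_prod_anticomm x s : pairwise anticomm s -> x \in s ->
  x * \prod_(y <- s) y = (-1) ^+ (size s).-1 * (\prod_(y <- s) y * x).
Proof.
elim: s => [|y s IHs] //= /andP[/allP ys sP]; rewrite big_cons inE.
case/predU1P => [->|xs].
  by rewrite -(mulrA y) [in LHS]prod_anticomm // (mulrA y _ (_ * _)) commr_sign !mulrA.
case: s xs ys sP IHs => // z s xs ys sP IHs.
have xy : anticomm x y by rewrite anticomm_sym; apply: ys.
rewrite mulrA (eqP xy) mulNr -(mulrA y x) IHs //=.
by rewrite exprS mulN1r mulNr (mulrA y) commr_sign !mulrA.
Qed.

(** [star] reverses the product and gives a sign [b] for each factor; restoring the order of n
    anticommuting factors takes 'C(n, 2) transpositions. *)
Lemma prod_star_unit b s : {in s, forall x, star_unit b x} ->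
  pairwise anticomm s ->
  star_unit (odd (size s * b + 'C(size s, 2))) (\prod_(x <- s) x).
Proof.
rewrite /star_unit signr_odd.
elim: s => [|x s IHs] sb /=; first by rewrite big_nil star1 !mul1r.
have [x1 xs] := sb x (mem_head _ _).
case/andP=> /allP xs' sP; have [|w1 ws] := IHs _ sP.
  by move=> y ys; apply: sb; rewrite inE ys orbT.
rewrite big_cons starM; split; first by rewrite mulrA -(mulrA x) w1 mulr1.
set N := (size s * b + _)%N in ws *.
rewrite ws xs binS bin1 (_ : _ + _ = N + b + size s)%N; last by rewrite /N; lia.
rewrite exprD -mulrA (prod_anticomm xs') signrMK exprD -!mulrA; congr (_ * _).
by rewrite mulrA commr_sign mulrA.
Qed.

(** [star] reverses [x * u], and putting the factors back in order costs the sign that negates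
    [b]. *)
Lemma star_unit_mul b x u : star_unit b x -> star_unit false u ->
  anticomm x u -> star_unit (~~ b) (x * u).
Proof.
move=> [x1 xs] [u1 us] /eqP xu; rewrite /star_unit starM; split.
  by rewrite mulrA -(mulrA x) u1 mulr1.
rewrite us xs mul1r xu mulrN -mulNr -signrN.
by rewrite mulrA commr_sign mulrA negbK.
Qed.

Lemma mulM_anticomm x y u : u * u = 1 -> anticomm y u ->
  (x * u) * (y * u) = - (x * y).
Proof.
move=> u1 /eqP yu; rewrite yu mulrN mulrA -(mulrA x) u1 mulr1 //.
Qed.

Lemma mul_anticomm x y u : u * u = 1 -> anticomm x u -> anticomm y u ->
  anticomm x y -> anticomm (x * u) (y * u).
Proof.
by move=> u1 xu yu /eqP xy; rewrite /anticomm !mulM_anticomm // xy.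
Qed.

Lemma pairwise_anticommC s t :
  pairwise anticomm (s ++ t) = pairwise anticomm (t ++ s).
Proof.
rewrite !pairwise_cat allrelC [X in _ && X]andbC; congr (_ && _).
by apply: eq_allrel => x y; rewrite anticomm_sym.
Qed.

Lemma pairwise_mul u s : u * u = 1 -> (forall x, x \in s -> anticomm x u) ->
  pairwise anticomm s -> pairwise anticomm [seq x * u | x <- s].
Proof.
move=> u1 su; rewrite pairwise_map.
apply: (@sub_in_pairwise _ [in s]); last exact/allP.
by move=> x y xs ys xy /=; apply: mul_anticomm => //; apply: su.
Qed.

(** With [e] the first positive vector, [x * e] has the opposite sign to [x] by [star_unit_mul], so
    [ns] becomes positive and [ps] negative, while [e] stays positive. Generation survives because x
    = (x e) e. *)
Lemma clifford_system_swap p q :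
  clifford_system p.+1 q -> clifford_system q.+1 p.
Proof.
case=> -[[? []//]|e ps] [ns [[sp] sq [pP nP /= /andP[/allP eA sP] gen]]].
have e1 := pP e (mem_head _ _); have ee := star_unit_sq e1.
have Ae x : x \in ps ++ ns -> anticomm x e.
  by move=> xs; rewrite anticomm_sym; apply: eA.
exists (e :: [seq x * e | x <- ns]), [seq x * e | x <- ps]; split.
- by rewrite /= size_map sq.
- by rewrite size_map.
split.
- move=> x; rewrite inE => /predU1P[-> //|/mapP[y ys ->]].
  by apply: (@star_unit_mul true) => //; [exact: nP | rewrite Ae // mem_cat ys orbT].
- move=> x /mapP[y ys ->].
  apply: (@star_unit_mul false) => //; last by rewrite Ae // mem_cat ys.
  by apply: pP; rewrite inE ys orbT.
- rewrite /= -map_cat; apply/andP; split.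
    apply/allP => x /mapP[y ys ->]; rewrite /anticomm mulrA.
    by rewrite (eqP (eA _ _)) ?mulNr // mem_cat orbC -mem_cat.
  apply: pairwise_mul; rewrite 1?pairwise_anticommC //.
  by move=> x; rewrite mem_cat orbC -mem_cat => /Ae.
- move=> S Salg genS; apply: gen => // x.
  have Se : S e by apply: genS; rewrite mem_head.
  rewrite inE => /predU1P[-> //|xs]; case: (Salg) => _ _ SM.
  rewrite -[x]mulr1 -[1]ee mulrA; apply: SM => //; apply: genS.
  by move: xs; rewrite !(mem_cat, inE) => /orP[] /(map_f ( *%R^~ e)) /= ->;
  rewrite ?orbT.
Qed.

(** The product [w] of four positive vectors is self-adjoint, as 'C(4, 2) is even. It anticommutes
    with each of the four (three signs) and commutes with all the others (four signs), so replacing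
    the four by their products with [w] makes them negative and keeps all anticommutations. *)
Lemma clifford_system_flip4 p q :
  clifford_system (4 + p) q -> clifford_system p (4 + q).
Proof.
case=> ps0 [ns [sp0 sq [pP nP sP gen]]].
pose s := take 4 ps0; pose ps := drop 4 ps0.
have s4 : size s = 4 by rewrite size_takel // sp0.
have sp : size ps = p by rewrite size_drop sp0 addKn.
rewrite -[ps0](cat_take_drop 4) -/s -/ps in pP sP gen; rewrite -catA in sP gen.
move: sP; rewrite pairwise_cat => /and3P[/allrelP sA sP tP].
pose w := \prod_(x <- s) x.
have w1 : star_unit false w.
  have := @prod_star_unit false s; rewrite s4; apply=> // x xs.
  by apply: pP; rewrite mem_cat xs.
have ww := star_unit_sq w1.
have sw x : x \in s -> anticomm x w.
  by move=> xs; rewrite /anticomm mem_prod_anticomm // s4 -signr_odd /= expr1 mulN1r.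
have tw x : x \in ps ++ ns -> x * w = w * x.
  move=> xt; have := @prod_anticomm x s.
  rewrite s4 -signr_odd /= expr0 mul1r; apply=> y ys.
  by rewrite anticomm_sym sA.
exists ps, ([seq x * w | x <- s] ++ ns); split=> //.
  by rewrite size_cat size_map s4 sq.
split.
- by move=> x xs; apply: pP; rewrite mem_cat xs orbT.
- move=> x; rewrite mem_cat => /orP[/mapP[y ys ->]|/nP//].
  apply: (@star_unit_mul false) => //; last exact: sw.
  by apply: pP; rewrite mem_cat ys.
- rewrite pairwise_anticommC -catA pairwise_cat; apply/and3P; split.
  + apply/allrelP => _ x /mapP[y ys ->] xt.
    rewrite mem_cat orbC -mem_cat in xt.
    by rewrite /anticomm -mulrA -tw // !mulrA (eqP (sA _ _ ys xt)) mulNr.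
  + exact: pairwise_mul.
  + by rewrite pairwise_anticommC.
- move=> S Salg genS; case: (Salg) => _ _ SM.
  have Ss x : x \in s -> S (x * w).
    by move=> /(map_f ( *%R^~ w)) xs; apply: genS; rewrite !mem_cat xs ?orbT.
  have Sw : S w.
    have [e1 [e2 [e3 [e4 sE]]]] : exists x y z t : A, s = [:: x; y; z; t].
      by move: s4; case: (s) => [|x [|y [|z [|t []]]]] // _; exists x, y, z, t.
    (* Each pair gives (e1 w)(e2 w) = - e1 e2, and the two signs cancel; once [w] is recovered, so
       is each x = (x w) w. *)
    have -> : w = (e1 * w) * (e2 * w) * ((e3 * w) * (e4 * w)).
      rewrite !mulM_anticomm ?sw ?sE ?inE ?eqxx ?orbT // mulrNN.
      by rewrite /w sE !big_cons big_nil mulr1 !mulrA.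
    by apply: (SM); apply: (SM); apply: Ss; rewrite sE !inE eqxx ?orbT.
  apply: gen => // x; rewrite mem_cat => /orP[xs|xt].
    by rewrite -[x]mulr1 -[1]ww mulrA; apply: (SM) => //; apply: Ss.
  by apply: genS; move: xt; rewrite !mem_cat => /orP[] ->; rewrite ?orbT.
Qed.

End CliffordSystems.

(** * Passage from A to A x A *)

Lemma scale_halfD (R : numFieldType) (V : lmodType R) (v : V) :
  2^-1 *: v + 2^-1 *: v = v.
Proof.
by rewrite -scalerDl -mulr2n -(mulr_natr 2^-1) mulVf ?scale1r // pnatr_eq0.
Qed.

(** For n = 4m + 2 the product [w] is skew-adjoint and, n - 1 being odd, anticommutes with every
    generator; so (w, -w) can join the diagonal vectors (x, x). *)
Lemma clifford_system_double (R : numFieldType) (A : starAlgType R) m :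
  clifford_system A 0 (4 * m + 2) -> clifford_system (A * A)%type 0 (4 * m + 3).
Proof.
case=> ps [ns [/size0nil-> sn [_ nP sP gen]]]; rewrite /= in sP gen.
pose w := \prod_(x <- ns) x.
have w1 : star_unit true w.
  rewrite -[true](_ : odd (size ns * true + 'C(size ns, 2)) = true).
    exact: prod_star_unit.
  (* The binomial coefficient is 8m^2 + 6m + 1, which is odd, and n itself is even. *)
  rewrite sn bin2 (_ : _ * _.-1 = (8 * m ^ 2 + 6 * m + 1).*2)%N; first by rewrite doubleK; lia.
  by rewrite (_ : _.-1 = 4 * m + 1)%N; lia.
have nw x : x \in ns -> anticomm x w.
  move=> xs; rewrite /anticomm mem_prod_anticomm // sn -signr_odd.
  by rewrite (_ : odd _ = true) ?expr1 ?mulN1r //; lia.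
have ww := star_unit_sq w1; rewrite /= expr1 in ww.
exists [::], ((w, - w) :: [seq (x, x) | x <- ns]); split=> //.
  by rewrite /= size_map sn addn3 addn2.
split=> //.
- move=> x; rewrite inE => /predU1P[->|/mapP[y /nP[y1 ys] ->]].
    case: w1 => w1 ws; rewrite /star_unit expr1; split.
      by congr pair; rewrite /= ?starN ?mulrNN w1.
    rewrite mulN1r; congr pair; first by rewrite /= ws expr1 mulN1r.
    by rewrite /= starN ws expr1 mulN1r.
  rewrite /star_unit expr1 mulN1r; split; first by congr pair.
  by congr pair; rewrite /= ys expr1 mulN1r.
- rewrite /=; apply/andP; split.
    apply/allP => _ /mapP[x xs ->]; apply/eqP; have /eqP xw := nw x xs.
    by congr pair; rewrite /= ?mulNr ?mulrN xw ?opprK.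
  rewrite pairwise_map; apply: sub_pairwise sP => x y /eqP xy.
  by apply/eqP; congr pair.
- move=> S Salg genS [x y]; case: (Salg) => S1 SL SM.
  have Sd z : S (z, z).
    apply: (gen (fun z => S (z, z))) => [|t ts].
      by split=> // [a|] t u St Su; [apply: (SL a _ _ St Su) | apply: (SM _ _ St Su)].
    by apply: genS; rewrite inE map_f ?orbT.
  (* From w^2 = -1, (w, -w)(w, w) = (-1, 1). Together with the diagonal, (1, -1) separates the two
     factors. *)
  have Sv : S (1, -1).
    have Sw : S (w, - w) by apply: genS; rewrite mem_head.
    have := subalgN Salg (SM _ _ Sw (Sd w)).
    congr S; congr pair; rewrite /= ?mulNr ww ?opprK //.
  have -> : (x, y) = 2^-1 *: (x + y, x + y) + (2^-1 *: (x - y, x - y)) * (1, -1).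
    congr pair; rewrite /= ?mulr1 ?mulrN1 -?scalerDr -?scalerBr.
      by rewrite addrACA subrr addr0 scalerDr scale_halfD.
    by rewrite opprB (addrC x) addrACA subrr addr0 scalerDr scale_halfD.
  by apply: (SL) => //; apply: (SM) => //; apply: subalgZ.
Qed.

(** * Two-by-two block matrices and passage from M(m, K) to M(2m, K) *)

Section CastBlock.
Variables (T : nzRingType) (n m : nat) (E : (n + n = m)%N).
Implicit Types a b c d : 'M[T]_n.

(** The size [m] is a variable tied to [n + n] by [E], so that case analysis on [E] removes the
    cast; it is used with m = 2 ^ e.+1. *)
Definition cast_block a b c d : 'M_m := castmx (E, E) (block_mx a b c d).

Lemma cast_blockP (x : 'M_m) : exists a b c d, x = cast_block a b c d.
Proof.
rewrite /cast_block; case: m / E x => x; rewrite -[x]submxK.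
by do 4!eexists; rewrite castmx_id.
Qed.

Lemma cast_block1 : 1%:M = cast_block 1%:M 0 0 1%:M.
Proof. by rewrite /cast_block; case: m / E; rewrite castmx_id -scalar_mx_block. Qed.

Lemma cast_blockD a b c d a' b' c' d' :
  cast_block a b c d + cast_block a' b' c' d' =
  cast_block (a + a') (b + b') (c + c') (d + d').
Proof. by rewrite /cast_block; case: m / E; rewrite !castmx_id add_block_mx. Qed.

Lemma cast_blockM a b c d a' b' c' d' :
  cast_block a b c d *m cast_block a' b' c' d' =
  cast_block (a *m a' + b *m c') (a *m b' + b *m d')
             (c *m a' + d *m c') (c *m b' + d *m d').
Proof. by rewrite /cast_block; case: m / E; rewrite !castmx_id mulmx_block. Qed.

Lemma map_cast_block f a b c d : map_mx f (cast_block a b c d) =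
  cast_block (map_mx f a) (map_mx f b) (map_mx f c) (map_mx f d).
Proof. by rewrite /cast_block; case: m / E; rewrite !castmx_id map_block_mx. Qed.

Lemma tr_cast_block a b c d :
  (cast_block a b c d)^T = cast_block a^T c^T b^T d^T.
Proof. by rewrite /cast_block; case: m / E; rewrite !castmx_id tr_block_mx. Qed.

End CastBlock.

Section BlockDoubling.
Variables (R : numFieldType) (K : starAlgType R) (e : nat).
Local Notation A := (mxalg K e).
Local Notation B := (mxalg K e.+1).

Fact addnn_expn2 : (2 ^ e + 2 ^ e = 2 ^ e.+1)%N.
Proof. by rewrite expnS mul2n addnn. Qed.

Definition blk (a b c d : A) : B := cast_block addnn_expn2 a b c d.

Lemma blkP (x : B) : exists a b c d, x = blk a b c d.
Proof. exact: (cast_blockP addnn_expn2). Qed.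

Lemma blk1 : 1 = blk 1 0 0 1.
Proof. exact: cast_block1. Qed.

Lemma blkD a b c d a' b' c' d' :
  blk a b c d + blk a' b' c' d' = blk (a + a') (b + b') (c + c') (d + d').
Proof. exact: cast_blockD. Qed.

Lemma blkM a b c d a' b' c' d' : blk a b c d * blk a' b' c' d' =
  blk (a * a' + b * c') (a * b' + b * d') (c * a' + d * c') (c * b' + d * d').
Proof. exact: cast_blockM. Qed.

Lemma blkZ (t : R) a b c d :
  t *: blk a b c d = blk (t *: a) (t *: b) (t *: c) (t *: d).
Proof. exact: map_cast_block. Qed.

Lemma blkN a b c d : - blk a b c d = blk (- a) (- b) (- c) (- d).
Proof. by rewrite -scaleN1r blkZ !scaleN1r. Qed.

Lemma blk_star a b c d :
  star (blk a b c d) = blk (star a) (star c) (star b) (star d).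
Proof.
have trE f (x : mxalg K f) : star x = map_mx star x^T.
  by apply/matrixP => i j; rewrite !mxE.
by rewrite !trE [RHS](esym (map_cast_block _ _ _ _ _ _)) -tr_cast_block.
Qed.

Local Notation blk_simp := (mul0r, mulr0, add0r, addr0, mul1r, mulr1, mulrN,
  mulNr, oppr0, opprK, mulN1r, mulrN1).

(** The old vectors become diag(x, -x), whose opposite signs make them anticommute with the two new
    off-diagonal vectors [u] and [v]. *)
Lemma clifford_system_mxalgS p q :
  clifford_system A p q -> clifford_system B p.+1 q.+1.
Proof.
case=> ps [ns [sp sq [pP nP sP gen]]].
pose u := blk 0 1 1 0; pose v := blk 0 1 (- 1) 0.
pose h x := blk x 0 0 (- x).
have hP b x : star_unit b x -> star_unit b (h x).
  case=> x1 xs; rewrite /star_unit /h blk_star star0 starN blkM !blk_simp x1.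
  split; first by rewrite -blk1.
  by rewrite xs; case: (b); rewrite /= ?expr1 ?expr0 !blk_simp ?blkN ?blk_simp.
have u1 : star_unit false u.
  by rewrite /star_unit /u blk_star star0 star1 blkM !blk_simp -blk1.
have v1 : star_unit true v.
  rewrite /star_unit /v blk_star star0 starN star1 blkM expr1 !blk_simp.
  by rewrite -blk1 blkN !blk_simp.
have hu x : anticomm u (h x).
  by apply/eqP; rewrite /u /h !blkM blkN !blk_simp.
have hv x : anticomm v (h x).
  by apply/eqP; rewrite /v /h !blkM blkN !blk_simp.
have uv : anticomm u v.
  by apply/eqP; rewrite /v /u !blkM blkN !blk_simp.
exists (u :: [seq h x | x <- ps]), (v :: [seq h x | x <- ns]).
split; rewrite ?[size _]/= ?size_map ?sp ?sq //; split.
- by move=> x; rewrite inE => /predU1P[-> //|/mapP[y /pP yP ->]]; apply: hP.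
- by move=> x; rewrite inE => /predU1P[-> //|/mapP[y /nP yP ->]]; apply: hP.
- rewrite /=; apply/andP; split.
    apply/allP => x; rewrite mem_cat inE => /or3P[/mapP[y _ ->]|/eqP-> //|].
      exact: hu.
    by case/mapP => y _ ->; apply: hu.
  rewrite pairwise_anticommC /= -map_cat; apply/andP; split.
    by apply/allP => _ /mapP[x _ ->]; apply: hv.
  rewrite pairwise_map; move: sP; rewrite pairwise_anticommC.
  apply: sub_pairwise => x y /eqP xy; apply/eqP.
  by rewrite /h !blkM blkN !blk_simp xy.
- move=> S Salg genS x; case: (Salg) => S1 SL SM.
  have Su : S u by apply: genS; rewrite mem_head.
  have Sv : S v by apply: genS; rewrite mem_cat mem_head orbT.
  have Sh z : z \in ps ++ ns -> S (h z).
    rewrite mem_cat => /orP[] zs; apply: genS;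
    by rewrite !(mem_cat, inE) (map_f h zs) ?orbT.
  (* The product of the new vectors is diag(1, -1), which turns diag(x, -x) into diag(x, x). *)
  have vu : v * u = h 1 by rewrite /u /v blkM !blk_simp.
  have S1h : S (h 1) by rewrite -vu; apply: SM.
  have Sd z : S (blk z 0 0 z).
    apply: (gen (fun z => S (blk z 0 0 z))) => [|t ts].
      split=> [|a t t' St St'|t t' St St']; first by rewrite -blk1.
        by have := SL a _ _ St St'; rewrite blkZ blkD !scaler0 !addr0.
      by have := SM _ _ St St'; rewrite blkM !blk_simp.
    by have := SM _ _ (Sh _ ts) S1h; rewrite /h blkM !blk_simp.
  have SD := subalgD Salg.
  (* 1 + diag(1, -1) is twice the upper left idempotent, whence the factor 1/2. The other three
     blocks follow by taking the complementary idempotent and by multiplying with [u]. *)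
  have Sul z : S (blk z 0 0 0).
    have := SM _ _ (Sd (2^-1 *: z)) (SD _ _ S1 S1h).
    by rewrite blk1 blkD blkM addrN !blk_simp mulrDr mulr1 scale_halfD.
  have Sur z : S (blk 0 z 0 0).
    by have := SM _ _ (Sul z) Su; rewrite blkM !blk_simp.
  have Sdr z : S (blk 0 0 0 z).
    have := SM _ _ (Sd z) (SD _ _ S1 (subalgN Salg (Sul 1))).
    by rewrite blk1 blkN blkD blkM addrN !blk_simp.
  have Sdl z : S (blk 0 0 z 0).
    by have := SM _ _ (Sdr z) Su; rewrite blkM !blk_simp.
  have [a [b [c [d ->]]]] := blkP x.
  have := SD _ _ (SD _ _ (Sul a) (Sur b)) (SD _ _ (Sdl c) (Sdr d)).
  by rewrite !blkD !blk_simp.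
Qed.

End BlockDoubling.

(** * Spanning Cl(n) by 2^n elements *)

(** The image of [f] plays the role of the span of the ordered products of subsets of [s]. By
    induction, adding [x] replaces a span W by W + W x, which remains stable under right
    multiplication. *)
Lemma anticomm_span (R : comNzRingType) (A : algType R) (s : seq A) :
  (forall x, x \in s -> exists a : R, x * x = a%:A) -> pairwise (@anticomm A) s ->
  exists2 f : {linear 'rV[R]_(2 ^ size s) -> A}, exists u, f u = 1
    & forall x u, x \in s -> exists v, f u * x = f v.
Proof.
move=> sqs sP.
(* The dimension is abstracted so that the inductive step can use [2 ^ size s + 2 ^ size s] and
   split its rows into two blocks. *)
suff [d [dE [f f1 fs]]] : exists d, d = (2 ^ size s)%N /\
    exists2 f : {linear 'rV[R]_d -> A}, exists u, f u = 1
      & forall x u, x \in s -> exists v, f u * x = f v.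
  by case: _ / dE; exists f.
elim: s sqs sP => [|x s IHs] sqs /=.
  move=> _; exists 1; split=> //.
  pose f (u : 'rV[R]_1) : A := (u 0 0)%:A.
  have f_lin : linear f by move=> a u v; rewrite /f !mxE scalerDl scalerA.
  pose fL := GRing.isLinear.Build R 'rV[R]_1 A _ f f_lin.
  pose f' : {linear 'rV[R]_1 -> A} := HB.pack f fL.
  by exists f' => //; exists (const_mx 1); rewrite /= /f mxE scale1r.
case/andP=> /allP xs /IHs[y ys|d [-> [f [u1 fu1] fs]]].
  by apply: sqs; rewrite inE ys orbT.
exists (2 ^ size s + 2 ^ size s)%N; split; first by rewrite expnS mul2n addnn.
pose g (u : 'rV[R]_(2 ^ size s + 2 ^ size s)) := f (lsubmx u) + f (rsubmx u) * x.
have g_lin : linear g.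
  move=> a u v; rewrite /g !linearP /= mulrDl scalerDr -scalerAl.
  by rewrite -!addrA; congr (_ + _); rewrite addrCA.
pose gL := GRing.isLinear.Build R _ A _ g g_lin.
pose g' : {linear _ -> A} := HB.pack g gL.
have gE u v : g' (row_mx u v) = f u + f v * x by rewrite /= /g row_mxKl row_mxKr.
exists g'; first by exists (row_mx u1 0); rewrite gE fu1 linear0 mul0r addr0.
move=> y u; rewrite -[u]hsubmxK inE; move: (lsubmx u) (rsubmx u) => v w.
case/predU1P => [->|ys].
  have [a xa] := sqs x (mem_head _ _).
  (* (f v + f w x) x = a f w + f v x, since x^2 = a. *)
  exists (row_mx (a *: w) v).
  by rewrite !gE mulrDl -mulrA xa linearZ /= -scalerAr mulr1 addrC.
have [v' vE] := fs y v ys; have [w' wE] := fs y w ys.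
(* [y] crosses [x] with a sign before acting on [f w]. *)
exists (row_mx v' (- w')); rewrite !gE mulrDl vE linearN /= -wE -mulrA.
by rewrite (eqP (xs y ys)) mulrN mulNr mulrA.
Qed.

Section CliffordMaps.
Variables (R : realType) (n : nat).

(** Polarization: the quadratic relation at e_i + e_j, minus those at e_i and e_j. *)
Lemma clifford_map_anticomm (A : algType R) (f : {linear 'rV[R]_n -> A}) i j :
  is_clifford_map f -> i != j -> anticomm (f (delta_mx 0 i)) (f (delta_mx 0 j)).
Proof.
move=> fP ij; have := fP (delta_mx 0 i + delta_mx 0 j).
rewrite linearD mulrDl !mulrDr !fP.
have dot k l : stdform (delta_mx 0 k) (delta_mx 0 l) = (k == l)%:R :> R.
  rewrite /stdform (bigD1 k) //= big1 => [|m mk]; last first.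
    by rewrite !mxE (negPf mk) mul0r.
  by rewrite !mxE !eqxx mul1r addr0.
have -> : stdform (delta_mx 0 i + delta_mx 0 j)
    (delta_mx 0 i + delta_mx 0 j) = 1 + 1 :> R.
  transitivity (\sum_(p <- [:: (i, i); (i, j); (j, i); (j, j)])
     stdform (delta_mx 0 p.1) (delta_mx 0 p.2 : 'rV[R]_n)).
    rewrite !big_cons big_nil /= addr0 /stdform -!big_split /=.
    by apply: eq_bigr => k _; rewrite !mxE; ring.
  rewrite !big_cons big_nil /= !dot !eqxx (eq_sym j) (negPf ij).
  by rewrite !(addr0, add0r, mulr1n).
rewrite !dot !eqxx scalerDl scale1r opprD -addrA => /addrI.
by rewrite addrA -[X in _ = X]add0r => /addIr/eqP; rewrite addr_eq0.
Qed.

(* By the universal property, Cl is a retract of the algebra of terms. *)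
Lemma clifford_term (Cl : algType R) (iota : {linear 'rV[R]_n -> Cl}) (x : Cl) :
  is_clifford_algebra iota -> exists t, x = cleval iota t.
Proof.
case=> iotaP univ.
have vecP : is_clifford_map (@clvec R n).
  move=> v; apply: clquotP => A f fP; have [ev evE] := clev_lrmorphism fP.
  rewrite -!evE [LHS](rmorphM ev) [RHS](lrmorph_oppalg ev).
  have evv : ev (clvec v) = f v by rewrite evE clev_pi.
  exact: etrans (congr2 *%R evv evv) (fP v).
have [[g gE] _] := univ _ _ vecP; have [h hE] := clev_lrmorphism iotaP.
have hgE : (h \o g : {lrmorphism Cl -> Cl}) =1 idfun.
  have [_] := univ _ _ iotaP; apply=> // v.
  by rewrite /= gE hE clev_pi.
by exists (repr (g x)); rewrite -[LHS]hgE /= hE.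
Qed.

Lemma linear_row_sum (A : algType R) (f : {linear 'rV[R]_n -> A}) (v : 'rV[R]_n) :
  f v = \sum_i v 0 i *: f (delta_mx 0 i).
Proof. by rewrite {1}(row_sum_delta v) linear_sum; under eq_bigr do rewrite linearZ. Qed.

(** Every element is a term in the vectors, and the span given by [anticomm_span] contains 1 and is
    stable under right multiplication by the basis vectors, hence by all terms. *)
Lemma clifford_span (Cl : algType R) (iota : {linear 'rV[R]_n -> Cl}) :
  is_clifford_algebra iota ->
  exists f : {linear 'rV[R]_(2 ^ n) -> Cl}, forall x, exists u, x = f u.
Proof.
move=> iotaA; case: (iotaA) => iotaP _.
pose s := [seq iota (delta_mx 0 i) | i <- enum 'I_n].
have sz : size s = n by rewrite size_map size_enum_ord.
have [] := @anticomm_span R Cl s.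
- move=> _ /mapP[i _ ->]; exists (- stdform (delta_mx 0 i) (delta_mx 0 i)).
  by rewrite iotaP scaleNr.
- rewrite pairwise_map; have := enum_uniq 'I_n; rewrite uniq_pairwise.
  by apply: sub_pairwise => i j; apply: clifford_map_anticomm.
rewrite sz => f [u1 f1] fs; exists f => x; have [t ->] := clifford_term x iotaA.
(* Replacing 1 by an arbitrary [f u1] lets the induction treat a product of terms as two successive
   right multiplications. *)
suff [u uE] : exists u, f u1 * cleval iota t = f u.
  by exists u; rewrite -uE f1 mul1r.
elim: t u1 {f1} => [v|a|t1 IH1 t2 IH2|t1 IH1 t2 IH2] u /=.
- rewrite linear_row_sum mulr_sumr.
  elim/big_ind: _ => [|x1 x2 [u1 ->] [u2 ->]|i _].
  + by exists 0; rewrite linear0.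
  + by exists (u1 + u2); rewrite linearD.
  + have [|w wE] := fs (iota (delta_mx 0 i)) u.
      by apply/mapP; exists i; rewrite ?mem_enum.
    by exists (v 0 i *: w); rewrite -scalerAr wE linearZ.
- by exists (a *: u); rewrite -scalerAr mulr1 linearZ.
- have [u1 u1E] := IH1 u; have [u2 u2E] := IH2 u.
  by exists (u1 + u2); rewrite mulrDr u1E u2E linearD.
- by have [u1 u1E] := IH1 u; rewrite mulrA u1E; apply: IH2.
Qed.


End CliffordMaps.

(** * Lower bounds on dimensions *)

(** Expressed by a linear surjection onto R^d, so that [A] needs no finite-dimensional structure. *)
Definition has_dim_ge (R : comNzRingType) (A : lmodType R) d :=
  exists f : A -> 'rV[R]_d, linear f /\ forall v, exists x, f x = v.

Lemma dim_ge_pair (R : comNzRingType) (A B : lmodType R) d d' :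
  has_dim_ge A d -> has_dim_ge B d' -> has_dim_ge (A * B)%type (d + d').
Proof.
move=> [f [fL fS]] [g [gL gS]]; exists (fun x => row_mx (f x.1) (g x.2)).
split=> [a x y|v] /=; first by rewrite fL gL -add_row_mx scale_row_mx.
have [x xE] := fS (lsubmx v); have [y yE] := gS (rsubmx v).
by exists (x, y); rewrite xE yE hsubmxK.
Qed.

Lemma dim_ge_mxalg (R : comNzRingType) (K : starAlgType R) e d :
  has_dim_ge K d -> has_dim_ge (mxalg K e) (2 ^ e * 2 ^ e * d).
Proof.
move=> [f [fL fS]].
pose g (x : 'M[K]_(2 ^ e)) := mxvec (\matrix_k f (mxvec x 0 k)).
exists g; split=> [a x y|v].
  rewrite -[a *: _]/(map_mx ( *:%R a) x) /g -linearP; congr mxvec.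
  apply/matrixP => k l; case/mxvec_indexP: k => i j.
  by rewrite [LHS]mxE [RHS]mxE ![in RHS]mxE !mxvecE [in LHS]mxE [in LHS]mxE fL !mxE.
have [h hK] := boolp.choice fS.
exists (vec_mx (\row_k h (row k (vec_mx v))) : 'M_(2 ^ e)).
rewrite /g vec_mxK -[RHS]vec_mxK; congr mxvec.
by apply/row_matrixP => k; rewrite rowK mxE hK.
Qed.

(** * Signatures reached in matrix algebras *)

(** Transport along the star isomorphism of K with the matrices of size 2^0 = 1. *)
Lemma clifford_system_mxalg0 (R : comNzRingType) (K : starAlgType R) p q :
  clifford_system K p q -> clifford_system (mxalg K 0) p q.
Proof.
case=> ps [ns [sp sq [pP nP sP gen]]].
pose f (x : K) : mxalg K 0 := const_mx x.
have fM x y : f x * f y = f (x * y).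
  apply/matrixP => i j; rewrite !mxE.
  by rewrite (big_ord1 _ (fun k : 'I_(2 ^ 0) => f x i k * f y k j)) !mxE.
have fL a x y : f (a *: x + y) = a *: f x + f y by apply/matrixP => i j; rewrite !mxE.
have f1 : f 1 = 1.
  apply/matrixP => i j; rewrite !mxE; move: i j; rewrite expn0 => i j.
  by rewrite !ord1.
have fs x : star (f x) = f (star x) by apply/matrixP => i j; rewrite !mxE.
have f0 : f 0 = 0 by apply/matrixP => i j; rewrite !mxE.
have fN x : f (- x) = - f x by rewrite -!scaleN1r -[RHS]addr0 -f0 -fL addr0.
have fP b x : star_unit b x -> star_unit b (f x).
  case=> x1 xs; rewrite /star_unit fs fM x1 f1 xs; split=> //.
  by case: (b); rewrite /= ?expr1 ?expr0 ?mulN1r ?mul1r.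
exists (map f ps), (map f ns); rewrite !size_map; split=> //; split.
- by move=> _ /mapP[x /pP xP ->]; apply: fP.
- by move=> _ /mapP[x /nP xP ->]; apply: fP.
- rewrite -map_cat pairwise_map; apply: sub_pairwise sP => x y /eqP xy.
  by apply/eqP; rewrite !fM xy fN.
- move=> S [S1 SL SM] genS x.
  have -> : x = f (x (@Ordinal (2 ^ 0) 0 isT) (@Ordinal (2 ^ 0) 0 isT)).
    apply/matrixP => i j; rewrite !mxE.
    by move: i j => [[|//] i0] [[|//] j0]; congr (x _ _); apply: val_inj.
  apply: (gen (fun x => S (f x))) => [|y ys].
    by split=> [|a y z Sy Sz|y z Sy Sz]; rewrite ?f1 ?fL -?fM //; [apply: SL|apply: SM].
  by apply: genS; rewrite -map_cat map_f.
Qed.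

Lemma clifford_system_mxalg (R : numFieldType) (K : starAlgType R) e p q :
  clifford_system K p q -> clifford_system (mxalg K e) (e + p) (e + q).
Proof.
by elim: e => [/clifford_system_mxalg0|e IHe /IHe/clifford_system_mxalgS].
Qed.

Lemma clifford_system_flip (R : comNzRingType) (A : starAlgType R) k p q :
  clifford_system A (4 * k + p) q -> clifford_system A p (4 * k + q).
Proof.
elim: k q => [|k IHk] q; first by rewrite !muln0.
rewrite mulnS -addnA => /clifford_system_flip4/IHk.
by rewrite addnCA addnA.
Qed.

(** Makes all vectors negative when [q.+1], rather than the number of positive vectors, is a
    multiple of 4: a swap gives (4j, p), and j flips finish. *)
Lemma clifford_system_negative (R : comNzRingType) (A : starAlgType R) j p q :
  clifford_system A p.+1 q -> q.+1 = (4 * j)%N -> clifford_system A 0 (4 * j + p).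
Proof.
move=> /clifford_system_swap + qj; rewrite qj => sysA.
by apply: clifford_system_flip; rewrite addn0.
Qed.

(** * The base algebras R, C and H *)

Section BaseAlgebras.
Variable R : realType.

Lemma clifford_system_R : clifford_system R^o 0 0.
Proof.
exists [::], [::]; split=> //; split=> // S Salg _ x.
by rewrite -[x]mulr1; apply: (@subalgZ _ _ _ Salg x); case: Salg.
Qed.

Lemma clifford_system_C : clifford_system (Rcomplex R) 0 1.
Proof.
pose i : Rcomplex R := Complex 0 1.
exists [::], [:: i]; split=> //; split=> //.
- move=> x; rewrite inE => /eqP->; split; rewrite ?expr1 ?mulN1r; congr Complex;
  by rewrite /=; ring.
- move=> S Salg genS [a b]; case: (Salg) => S1 SL _.
  rewrite (_ : Complex a b = b *: i + (a *: 1 + 0)); last first.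
    by congr Complex; rewrite /=; ring.
  apply: (SL); first by apply: genS; rewrite inE.
  by apply: (SL) => //; apply: subalg0.
Qed.

Lemma clifford_system_H : clifford_system (quat R)^c 0 2.
Proof.
pose i : (quat R)^c := Quat 0 1 0 0; pose j : (quat R)^c := Quat 0 0 1 0.
exists [::], [:: i; j]; split=> //; split=> //.
- by move=> x; rewrite !inE => /orP[] /eqP->; split; rewrite ?expr1 ?mulN1r;
  congr Quat; rewrite /=; ring.
- by rewrite /= !andbT; apply/eqP; congr Quat; rewrite /=; ring.
- move=> S Salg genS [a b c d]; case: (Salg) => S1 SL SM.
  have Si : S i by apply: genS; rewrite inE eqxx.
  have Sj : S j by apply: genS; rewrite !inE (eqxx j) orbT.
  (* In the converse ring [j * i] is the quaternion product ij = k. *)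
  rewrite (_ : Quat a b c d = b *: i + (c *: j + (d *: (j * i) + (a *: 1 + 0)))); last first.
    by congr Quat; rewrite /=; ring.
  by do 4?[apply: (SL) => //]; [apply: SM | apply: subalg0].
Qed.

Lemma dim_ge_R : has_dim_ge R^o 1.
Proof.
exists (fun x => const_mx x); split=> [a x y|v]; last exists (v 0 0).
  by apply/matrixP => i j; rewrite !mxE.
by apply/matrixP => i j; rewrite !mxE !ord1.
Qed.

(** The sum [1 + 1] matches the row of two blocks, and computes to [2 ^ 1]. *)
Lemma dim_ge_C : has_dim_ge (Rcomplex R) (1 + 1).
Proof.
exists (fun x => row_mx (complex.Re x)%:M (complex.Im x)%:M).
split=> [a [x1 x2] [y1 y2]|v].
  by rewrite /= scale_row_mx add_row_mx -!mul_scalar_mx -!scalar_mxM -!raddfD.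
exists (Complex (lsubmx v 0 0) (rsubmx v 0 0)).
by rewrite /= -!mx11_scalar hsubmxK.
Qed.

Lemma dim_ge_H : has_dim_ge (quat R)^c ((1 + 1) + (1 + 1)).
Proof.
exists (fun x => row_mx (row_mx (q0 x)%:M (q1 x)%:M) (row_mx (q2 x)%:M (q3 x)%:M)).
split=> [a [x0 x1 x2 x3] [y0 y1 y2 y3]|v].
  by rewrite /= !scale_row_mx !add_row_mx -!mul_scalar_mx -!scalar_mxM -!raddfD.
pose l := lsubmx v; pose r := rsubmx v.
exists (Quat (lsubmx l 0 0) (rsubmx l 0 0) (lsubmx r 0 0) (rsubmx r 0 0)).
by rewrite /= -!mx11_scalar !hsubmxK.
Qed.

End BaseAlgebras.


(** * From a system of signature (0, n) to an isomorphism *)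

Lemma clifford_map_of_gens (R : realType) (A : algType R) n (e : 'I_n -> A) :
    (forall i, e i * e i = -1) -> (forall i j, i != j -> anticomm (e i) (e j)) ->
  exists2 f : {linear 'rV[R]_n -> A}, forall v, f v = \sum_i v 0 i *: e i
    & is_clifford_map f.
Proof.
move=> sqe ee; pose g (v : 'rV[R]_n) : A := \sum_i v 0 i *: e i.
have g_lin : linear g.
  move=> a v w; rewrite /g scaler_sumr -big_split; apply: eq_bigr => i _.
  by rewrite !mxE scalerDl scalerA.
pose gL := GRing.isLinear.Build R 'rV[R]_n A _ g g_lin.
pose g' : {linear 'rV[R]_n -> A} := HB.pack g gL.
exists g' => // v; rewrite -[g' v]/(g v).
pose F i j : A := (v 0 i * v 0 j) *: (e i * e j).
have gg : g v * g v = \sum_i \sum_j F i j.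
  rewrite mulr_suml; apply: eq_bigr => i _; rewrite mulr_sumr.
  by apply: eq_bigr => j _; rewrite /F -scalerAl -scalerAr scalerA.
have FF i j : F i j + F j i =
    if i == j then - (v 0 i * v 0 i + v 0 i * v 0 i)%:A else 0.
  rewrite /F (mulrC (v 0 j)) -scalerDr; case: eqVneq => [->|ij].
    by rewrite sqe -opprD scalerN scalerDr scalerDl.
  by rewrite (eqP (ee i j ij)) addNr scaler0.
have two (x y : A) : x + x = y + y -> x = y.
  rewrite -!mulr2n -!(scaler_nat 2) => /(scalerI _); apply.
  by rewrite pnatr_eq0.
(* The double sum for g(v)^2 is added to its transpose, so that the off-diagonal terms cancel in
   pairs; 2 is then divided out. *)
apply: two; rewrite gg [X in _ + X]exchange_big -big_split /=.
rewrite -opprD -scalerDl /stdform -big_split scaler_suml -sumrN.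
apply: eq_bigr => i _; rewrite -big_split (bigD1 i) //= FF eqxx big1 ?addr0 //.
by move=> j ji; rewrite FF eq_sym (negPf ji).
Qed.

Lemma clifford_star_iso (R : realType) n (A : starAlgType R) (Cl : algType R)
    (iota : {linear 'rV[R]_n -> Cl}) (c : {linear Cl -> Cl}) :
  clifford_system A 0 n -> has_dim_ge A (2 ^ n) ->
  is_clifford_algebra iota -> is_clifford_conj iota c ->
  exists rho : {lrmorphism Cl -> A},
    bijective rho /\ forall x, rho (c x) = star (rho x).
Proof.
case=> ps [ns [/size0nil-> sn [_ nP sP gen]]] [f [fL fS]] iotaA [cbij cM ci].
rewrite /= in sP gen.
have nsP (i : 'I_n) : star_unit true (nth 0 ns i) by apply: nP; rewrite mem_nth ?sn.
have nn (i j : 'I_n) : i != j -> anticomm (nth 0 ns i) (nth 0 ns j).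
  move=> ij; have ltP k l : (k < l < n)%N -> anticomm (nth 0 ns k) (nth 0 ns l).
    by case/andP=> kl ln; apply: (pairwiseP 0 sP); rewrite // inE sn ?(ltn_trans kl).
  move: ij; rewrite -val_eqE neq_ltn => /orP[] ij; last rewrite anticomm_sym.
    by apply: ltP; rewrite ij ltn_ord.
  by apply: ltP; rewrite ij ltn_ord.
have [|g gE gP] := clifford_map_of_gens _ nn.
  by move=> i; rewrite (star_unit_sq (nsP i)).
have [[rho rhoE] _] := (proj2 iotaA) _ _ gP.
have gi i : rho (iota (delta_mx 0 i)) = nth 0 ns i.
  rewrite rhoE gE (bigD1 i) //= big1 => [|j ji].
    by rewrite mxE !eqxx scale1r addr0.
  by rewrite mxE (negPf ji) andbF scale0r.
(* The image of [rho] is a subalgebra containing the generators. *)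
have rhoS y : exists x, rho x = y.
  apply: (gen (fun y => exists x, rho x = y)) => [|z /(nthP 0)[j j_n <-]].
    split=> [|a _ _ [x1 <-] [x2 <-]|_ _ [x1 <-] [x2 <-]].
    - by exists 1; rewrite rmorph1.
    - by exists (a *: x1 + x2); rewrite linearP.
    - by exists (x1 * x2); rewrite rmorphM.
  by rewrite sn in j_n; exists (iota (delta_mx 0 (Ordinal j_n))); rewrite gi.
have [h hS] := clifford_span iotaA.
(* The composite of [h], [rho] and [f] is a surjective endomorphism of R^(2^n), hence injective; so
   [rho (h u) = 0] forces u = 0. *)
have rho0 x : rho x = 0 -> x = 0.
  have [u ->] := hS x.
  pose fL' := GRing.isLinear.Build R A 'rV[R]_(2 ^ n) _ f fL.
  pose f' : {linear A -> 'rV[R]_(2 ^ n)} := HB.pack f fL'.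
  pose M := lin1_mx (f' \o rho \o h).
  have ME w : w *m M = f (rho (h w)) by rewrite mul_rV_lin1.
  have : row_full M.
    rewrite -sub1mx; apply/row_subP => i.
    have [y yE] := fS (row i 1%:M); have [z zE] := rhoS y; have [w wE] := hS z.
    by rewrite -yE -zE wE -ME submxMl.
  rewrite row_full_unit -row_free_unit => /row_free_inj Minj rhu.
  by rewrite (Minj _ u 0) ?linear0 // mul0mx ME rhu -[f]/(f' : _ -> _) linear0.
have rhoI : injective rho.
  by move=> x y xy; apply/subr0_eq/rho0; rewrite linearB /= xy subrr.
exists rho; split.
  have [k kE] := boolp.choice rhoS.
  by exists k => // x; apply: rhoI; rewrite kE.
(* Writing 1 = c d with d a preimage of 1, c 1 = (c 1)(c d) = c (d 1) = 1. *)
have c1 : c 1 = 1.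
  by case: cbij => d dK cK; rewrite -[LHS]mulr1 -{2}(cK 1) -cM mulr1 cK.
have gs v : star (g v) = - g v.
  rewrite !gE -sumrN (big_morph star (@starD _ A) (@star0 _ A)).
  apply: eq_bigr => i _; rewrite starZ -scalerN; congr (_ *: _).
  by case: (nsP i) => _ ->; rewrite expr1 mulN1r.
(* Both c and [star] are linear and reverse products, so agreement on vectors extends to all
   terms. *)
move=> x; have [t ->] := clifford_term x iotaA.
elim: t => [v|a|s IHs t IHt|s IHs t IHt] /=.
- by rewrite ci linearN /= !rhoE gs.
- by rewrite !linearZ /= c1 rmorph1 starZ star1.
- by rewrite !linearD /= IHs IHt starD.
- by rewrite cM !(rmorphM rho) starM; exact: congr2 IHt IHs.
Qed.

(** * The eight residues modulo 8 *)

Theorem proposition9p1 (R : realType) (k alpha : nat) (alpha_le7 : (alpha <= 7)%N)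
    (Cl : algType R) (iota : {linear 'rV[R]_(8 * k + alpha) -> Cl})
    (Cl_iota : is_clifford_algebra iota)
    (c : {linear Cl -> Cl}) (c_conj : is_clifford_conj iota c) :
  exists rho : {lrmorphism Cl -> clifford_mxalg R k alpha},
    bijective rho /\ forall x : Cl, rho (c x) = star (rho x).
Proof.
suff [sysA dimA] : clifford_system (clifford_mxalg R k alpha) 0 (8 * k + alpha) /\
    has_dim_ge (clifford_mxalg R k alpha) (2 ^ (8 * k + alpha)).
  exact: clifford_star_iso sysA dimA Cl_iota c_conj.
have sysE (A : starAlgType R) p q p' q' :
    clifford_system A p q -> p = p' -> q = q' -> clifford_system A p' q'.
  by move=> + <- <-.
have dimE (A : lmodType R) d d' : has_dim_ge A d -> d = d' -> has_dim_ge A d'.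
  by move=> + <-.
have dim_mx (K : starAlgType R) e b m : has_dim_ge K (2 ^ b) ->
    (2 * e + b = m)%N -> has_dim_ge (mxalg K e) (2 ^ m).
  move=> /(dim_ge_mxalg e) dimK <-; apply: dimE dimK _.
  by rewrite -!expnD mul2n -addnn.
have sysR := clifford_system_R R; have dimR := dim_ge_R R : has_dim_ge R^o (2 ^ 0).
have sysC := clifford_system_C R.
have dimC := dim_ge_C R : has_dim_ge (Rcomplex R) (2 ^ 1).
have sysH := clifford_system_H R.
have dimH := dim_ge_H R : has_dim_ge (quat R)^c (2 ^ 2).
(* Signatures: (0, 2), then (4k, 4k + 2) in matrices, then (0, 8k + 2) by k flips. Residues 0 and 1
   follow the same route. *)
have sys2 : clifford_system (mxH R (4 * k)) 0 (8 * k + 2).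
  have := clifford_system_flip (clifford_system_mxalg (4 * k) sysH).
  by move/sysE; apply; lia.
(* Signatures: (4k + 3, 4k + 3), swapped to (4k + 4, 4k + 2), then (0, 8k + 6) by k + 1 flips. *)
have sys6 : clifford_system (mxR R (4 * k + 3)) 0 (8 * k + 6).
  apply: (sysE _ 0 (4 * k.+1 + (4 * k + 2)))%N; [|by [] | by lia].
  apply: (@clifford_system_negative _ _ _ _ (4 * k + 3)); last by lia.
  by apply: sysE (clifford_system_mxalg (4 * k + 3) sysR) _ _; lia.
have dim2 : has_dim_ge (mxH R (4 * k)) (2 ^ (8 * k + 2)).
  by apply: dim_mx dimH _; lia.
have dim6 : has_dim_ge (mxR R (4 * k + 3)) (2 ^ (8 * k + 6)).
  by apply: dim_mx dimR _; lia.
case: alpha alpha_le7 {iota Cl_iota c_conj} => [|[|[|[|[|[|[|[|//]]]]]]]] _ /=.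
- split; last by apply: dim_mx dimR _; lia.
  have := clifford_system_flip (clifford_system_mxalg (4 * k) sysR).
  by move/sysE; apply; lia.
- split; last by apply: dim_mx dimC _; lia.
  have := clifford_system_flip (clifford_system_mxalg (4 * k) sysC).
  by move/sysE; apply; lia.
- by [].
- split; last first.
    by apply: dimE (dim_ge_pair dim2 dim2) _; rewrite addnn -mul2n -expnS -addnS.
  (* Doubling applies because 8k + 2 is 2 modulo 4; likewise 8k + 6 for residue 7. *)
  apply: (sysE _ 0 (4 * (2 * k) + 3))%N; [|by [] | by lia].
  by apply: clifford_system_double; apply: sysE sys2 _ _; lia.
- split; last by apply: dim_mx dimH _; lia.
  (* Signatures: (4k + 1, 4k + 3), swapped to (4k + 4, 4k), then (0, 8k + 4). *)
  apply: (sysE _ 0 (4 * k.+1 + 4 * k))%N; [|by [] | by lia].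
  apply: (@clifford_system_negative _ _ _ _ (4 * k + 3)); last by lia.
  by apply: sysE (clifford_system_mxalg (4 * k + 1) sysH) _ _; lia.
- split; last by apply: dim_mx dimC _; lia.
  (* Signatures: (4k + 2, 4k + 3), swapped to (4k + 4, 4k + 1), then (0, 8k + 5). *)
  apply: (sysE _ 0 (4 * k.+1 + (4 * k + 1)))%N; [|by [] | by lia].
  apply: (@clifford_system_negative _ _ _ _ (4 * k + 3)); last by lia.
  by apply: sysE (clifford_system_mxalg (4 * k + 2) sysC) _ _; lia.
- by [].
- split; last first.
    by apply: dimE (dim_ge_pair dim6 dim6) _; rewrite addnn -mul2n -expnS -addnS.
  apply: (sysE _ 0 (4 * (2 * k + 1) + 3))%N; [|by [] | by lia].
  by apply: clifford_system_double; apply: sysE sys6 _ _; lia.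
Qed.
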